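(* Let $Q$ be a quiver, $\mathbf d$ a dimension vector, and $\theta,\eta\in\mathrm{sst}(\mathbf d)$. Then $\theta$ and $\eta$ are GIT equivalent if and only if for every nonzero proper subdimension vector $\mathbf e\le\mathbf d$, the convex hull $[\theta,\eta]=\{t\theta+(1-t)\eta\mid t\in[0,1]\}$ is either contained in $W_{\mathbf e}$ or does not meet $W_{\mathbf e}$, where $W_{\mathbf e}=\mathrm{sst}(\mathbf e)\cap\mathrm{sst}(\mathbf d-\mathbf e)$.
   Context: Work over an algebraically closed field $k$ of characteristic zero. A quiver $Q$ is a finite directed graph (oriented cycles allowed) with vertex set $Q_0$, arrow set $Q_1$ and source and target maps $s,t$. For $\mathbf d\in\mathbb Z_{\ge0}^{Q_0}$ let $\mathrm R_{\mathbf d}=\bigoplus_{a\in Q_1}\mathrm{Hom}(k^{\mathbf d_{s(a)}},k^{\mathbf d_{t(a)}})$, whose elements are the representations of dimension vector $\mathbf d$. For $\theta\in\mathbb R^{Q_0}$ put $\theta(\mathbf e)=\sum_{i}\theta_i\mathbf e_i$, and $\theta(M)=\theta(\mathbf e)$ if $M$ has dimension vector $\mathbf e$. A representation $M$ is $\theta$-semistable if $\theta(M)=0$ and $\theta(M')\le0$ for all proper nonzero subrepresentations $M'$. Let $\mathrm R_{\mathbf d}^{\theta\text{-sst}}\subseteq\mathrm R_{\mathbf d}$ be the set of $\theta$-semistable representations, ${}^\perp\mathbf d=\{\theta\in\mathbb R^{Q_0}\mid\theta(\mathbf d)=0\}$, and $\mathrm{sst}(\mathbf d)=\{\theta\in{}^\perp\mathbf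 d\mid\mathrm R_{\mathbf d}^{\theta\text{-sst}}\ne\emptyset\}$. Two parameters $\theta,\eta\in{}^\perp\mathbf d$ are GIT equivalent if $\mathrm R_{\mathbf d}^{\theta\text{-sst}}=\mathrm R_{\mathbf d}^{\eta\text{-sst}}$. A subdimension vector of $\mathbf d$ is $\mathbf e\in\mathbb Z_{\ge0}^{Q_0}$ with $\mathbf e_i\le\mathbf d_i$ for all $i$ (written $\mathbf e\le\mathbf d$); it is proper if $\mathbf e\ne\mathbf d$. *)

(* Defs.v *)
From mathcomp Require Import all_boot all_order all_algebra.
From mathcomp Require Import boolp classical_sets reals.

Set Implicit Arguments.
Unset Strict Implicit.
Unset Printing Implicit Defensive.

Import Order.TTheory GRing.Theory Num.Theory.
Local Open Scope classical_set_scope.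
Local Open Scope ring_scope.

Record quiver := Quiver {
  vertex : finType;
  arrow : finType;
  source : arrow -> vertex;
  target : arrow -> vertex }.

Definition dimvec (Q : quiver) := vertex Q -> nat.

Definition subdimvec (Q : quiver) (e d : dimvec Q) : Prop :=
  forall i, (e i <= d i)%N.

(* The subtraction is truncated, hence meaningful only when [subdimvec e d]. *)
Definition subdv (Q : quiver) (d e : dimvec Q) : dimvec Q :=
  fun i => (d i - e i)%N.

(* Vectors are row vectors: the arrow [a] acts by [v |-> v *m M a], so that
   subspaces of [k^(d i)] can be handled as row spaces. *)
Definition rep (k : fieldType) (Q : quiver) (d : dimvec Q) :=
  forall a : arrow Q, 'M[k]_(d (source a), d (target a)).

(* A family of subspaces of the [k^(d i)], each one given as the row space of
   a square matrix (several matrices may describe the same subspace). *)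
Definition subspaces (k : fieldType) (Q : quiver) (d : dimvec Q) :=
  forall i : vertex Q, 'M[k]_(d i).

Definition subrep (k : fieldType) (Q : quiver) (d : dimvec Q)
    (M : rep k d) (U : subspaces k d) : Prop :=
  forall a : arrow Q, (U (source a) *m M a <= U (target a))%MS.

Definition dim_subspaces (k : fieldType) (Q : quiver) (d : dimvec Q)
    (U : subspaces k d) : dimvec Q :=
  fun i => \rank (U i).

Definition nonzero_subspaces (k : fieldType) (Q : quiver) (d : dimvec Q)
    (U : subspaces k d) : Prop :=
  exists i, U i != 0.

Definition proper_subspaces (k : fieldType) (Q : quiver) (d : dimvec Q)
    (U : subspaces k d) : Prop :=
  exists i, ~~ row_full (U i).

Definition weight (R : realType) (Q : quiver) (theta : vertex Q -> R)
    (e : dimvec Q) : R :=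
  \sum_i theta i * (e i)%:R.

Definition semistable (R : realType) (k : fieldType) (Q : quiver)
    (d : dimvec Q) (theta : vertex Q -> R) (M : rep k d) : Prop :=
  weight theta d = 0 /\
  forall U : subspaces k d, subrep M U ->
    nonzero_subspaces U -> proper_subspaces U ->
    weight theta (dim_subspaces U) <= 0.

Definition sst_locus (R : realType) (k : fieldType) (Q : quiver)
    (d : dimvec Q) (theta : vertex Q -> R) : set (rep k d) :=
  [set M | semistable theta M].
Arguments sst_locus {R} k {Q} d theta _.

Definition perp (R : realType) (Q : quiver) (d : dimvec Q) :
    set (vertex Q -> R) :=
  [set theta | weight theta d = 0].
Arguments perp {R Q} d _.

Definition sst (R : realType) (k : fieldType) (Q : quiver) (d : dimvec Q) :
    set (vertex Q -> R) :=
  [set theta | perp d theta /\ sst_locus k d theta !=set0].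
Arguments sst {R} k {Q} d _.

Definition git_equiv (R : realType) (k : fieldType) (Q : quiver)
    (d : dimvec Q) (theta eta : vertex Q -> R) : Prop :=
  sst_locus k d theta = sst_locus k d eta.
Arguments git_equiv {R} k {Q} d theta eta.

Definition wall (R : realType) (k : fieldType) (Q : quiver)
    (d e : dimvec Q) : set (vertex Q -> R) :=
  sst k e `&` sst k (subdv d e).
Arguments wall {R} k {Q} d e _.

Definition segment (R : realType) (Q : quiver) (theta eta : vertex Q -> R) :
    set (vertex Q -> R) :=
  [set zeta | exists2 t : R, 0 <= t <= 1 &
     zeta = (fun i => t * theta i + (1 - t) * eta i)].
Arguments segment {R Q} theta eta _.

(* Main.v *)
Require Import Defs.
From mathcomp Require Import all_boot all_order all_algebra.
From mathcomp Require Import boolp classical_sets reals.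
From mathcomp Require Import perm zify ring lra.

(** Walls imply equivalence.  Let [M] be [theta]-semistable but not
    [eta]-semistable, and move from [theta] towards [eta] until the last
    parameter [zeta] for which [M] is semistable.  There some subrepresentation
    [U] with [weight eta U > 0] has [weight zeta U = 0], so that [U] and [M / U]
    are [zeta]-semistable and [zeta] lies on the wall of [e = dim U]
    ([wall_crossing]).  The wall does not contain [eta], on which [e] has
    positive weight ([sst_locus_subset]).

    Equivalence implies walls.  The heart is [semistable_of_interp]: if
    [theta]-semistable representations are [eta]-semistable, then every
    representation [M0] that is semistable for some [zeta] of the segment other
    than [eta] is already [theta]-semistable.  Granting this, if [N] and [L]
    witness that [zeta] lies on the wall of [e], then [N (+) L] is
    [zeta]-semistable, hence [theta]- and [eta]-semistable, which forces
    [theta] and [eta] to vanish on [e] and makes [N] and [L] semistable for the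
    whole segment.

    For the heart, pick a [theta]-semistable [M1] and consider the pencil
    [M0 + X M1] over [k[X]].  A lattice is a family of full-rank submodules
    [row space of B_i] of the [k[X]^(d_i)], with cokernel supported at [X = 0],
    which the pencil maps into one another; in the bases [B_i] the pencil
    becomes another polynomial representation [N], with a fibre at [X = 0].
    Let [w theta B] be the [theta]-weight of the colengths [deg det B_i].

    - If the fibre of the ambient representation is [theta]-semistable, then
      [w theta B >= 0] for each sublattice ([colength_ge0]); dually, if the
      fibre of the sublattice is semistable then [w theta B <= 0]
      ([colength_le0]).
    - Replacing a lattice by the preimage of a subrepresentation [U] of its
      fibre lowers [w theta] by [weight theta U] ([elementary_modification]).
    - As [M1], the fibre of the pencil at infinity, is [theta]-semistable,
      [w theta] is bounded below over all lattices ([pencil_colength_bound]).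

    So destabilizing modifications, starting from the standard lattice, stop at
    a lattice with a [theta]-semistable fibre ([semistable_reduction]).  If [M0]
    was not [theta]-semistable then [w theta < 0] there.  The fibre is also
    [eta]-semistable, whence [w eta <= 0], whereas [w zeta >= 0] because [M0] is
    [zeta]-semistable: a contradiction, [w zeta] being a combination of
    [w theta] and [w eta] with a positive coefficient on the former. *)

Set Implicit Arguments.
Unset Strict Implicit.
Unset Printing Implicit Defensive.

Import Order.TTheory GRing.Theory Num.Theory.
Local Open Scope classical_set_scope.
Local Open Scope ring_scope.

(** * Weights and semistability *)

Section Weight.
Variables (R : realType) (Q : quiver).
Implicit Types (theta eta : vertex Q -> R) (e f d : dimvec Q).

Lemma weight_add theta d e f :
  (forall i, d i = (e i + f i)%N) -> weight theta d = weight theta e + weight theta f.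
Proof.
move=> dE; rewrite /weight -big_split; apply: eq_bigr => i _.
by rewrite dE natrD mulrDr.
Qed.

Lemma weight_sub theta d e :
  subdimvec e d -> weight theta (subdv d e) = weight theta d - weight theta e.
Proof.
move=> led; rewrite (@weight_add theta d e (subdv d e)); first by rewrite addrC addKr.
by move=> i; rewrite /subdv subnKC.
Qed.

Lemma weight_interp theta eta (t : R) e :
  weight (fun i => t * theta i + (1 - t) * eta i) e =
  t * weight theta e + (1 - t) * weight eta e.
Proof.
rewrite /weight !mulr_sumr -big_split; apply: eq_bigr => i _ /=.
by rewrite mulrDl !mulrA.
Qed.

Lemma eq_weight theta e f : e =1 f -> weight theta e = weight theta f.
Proof. by move=> ef; apply: eq_bigr => i _; rewrite ef. Qed.

Lemma weight_mull theta (m : nat) e :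
  weight theta (fun i => m * e i)%N = m%:R * weight theta e.
Proof.
rewrite /weight mulr_sumr; apply: eq_bigr => i _.
by rewrite natrM mulrCA.
Qed.

End Weight.

Section Semistable.
Variables (R : realType) (F : fieldType) (Q : quiver).
Implicit Types (theta eta : vertex Q -> R) (d e f : dimvec Q).

(** The trivial subrepresentations have weight zero, so they need no special
    treatment in the test for semistability. *)
Lemma weight_dim_leP d theta (M : rep F d) :
  semistable theta M <->
  weight theta d = 0 /\
  forall U : subspaces F d, subrep M U -> weight theta (dim_subspaces U) <= 0.
Proof.
split=> -[wd sst]; split=> // U sU; last by move=> _ _; apply: sst.
have [nzU|zU] := pselect (nonzero_subspaces U); last first.
  rewrite /weight big1 // => i _; rewrite /dim_subspaces.
  suff -> : U i = 0 by rewrite mxrank0 mulr0.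
  by apply/eqP/negP => /negP Ui; apply: zU; exists i.
have [pU|fU] := pselect (proper_subspaces U); first exact: sst.
rewrite -wd (@eq_weight _ _ _ _ d) // => i; apply/eqP.
by rewrite -[_ == _]/(row_full _); apply/negP => /negP Ui; apply: fU; exists i.
Qed.

(** Subspaces arise below as row spaces of matrices that are not square. *)
Lemma semistable_subrep d theta (M : rep F d) (n : vertex Q -> nat)
    (V : forall i, 'M[F]_(n i, d i)) :
  semistable theta M ->
  (forall a, (V (source a) *m M a <= V (target a))%MS) ->
  weight theta (fun i => \rank (V i)) <= 0.
Proof.
move=> /weight_dim_leP[_ sst] sV.
rewrite (@eq_weight _ _ _ _ (dim_subspaces (fun i => <<V i>>%MS))).
  apply: sst => a; rewrite (eqmxMr _ (genmxE _)) (submx_trans (sV a)) //.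
  by rewrite genmxE.
by move=> i; rewrite /dim_subspaces genmxE.
Qed.

Lemma semistable_interp d theta eta (t : R) (M : rep F d) :
  0 <= t <= 1 -> semistable theta M -> semistable eta M ->
  semistable (fun i => t * theta i + (1 - t) * eta i) M.
Proof.
move=> /andP[t0 t1] /weight_dim_leP[td tM] /weight_dim_leP[ed eM].
apply/weight_dim_leP; split=> [|U sU]; rewrite weight_interp.
  by rewrite td ed !mulr0 addr0.
have := tM U sU; have := eM U sU; nra.
Qed.

(** A decomposition of each [F^(d i)] into summands of dimensions [e i] and
    [f i], given by its injections and projections: keeping [d i] and
    [e i + f i] apart avoids transporting matrices along their equality. *)
Record splitting d e f := Splitting {
  spl_dim : forall i, d i = (e i + f i)%N;
  spl_in : forall i, 'M[F]_(e i, d i);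
  spl_out : forall i, 'M[F]_(d i, e i);
  spl_in' : forall i, 'M[F]_(f i, d i);
  spl_out' : forall i, 'M[F]_(d i, f i);
  spl_inK : forall i, spl_in i *m spl_out i = 1%:M;
  spl_inK' : forall i, spl_in' i *m spl_out' i = 1%:M;
  spl_in0 : forall i, spl_in i *m spl_out' i = 0;
  spl_in0' : forall i, spl_in' i *m spl_out i = 0;
  spl_outK : forall i, spl_out i *m spl_in i + spl_out' i *m spl_in' i = 1%:M }.

Lemma splitting_mx (n r s : nat) : (r + s)%N = n ->
  exists (p : 'M[F]_(r, n)) (p' : 'M[F]_(n, r)) (q : 'M[F]_(s, n)) (q' : 'M[F]_(n, s)),
  [/\ p = pid_mx r, p *m p' = 1%:M, q *m q' = 1%:M, p *m q' = 0
    & q *m p' = 0 /\ p' *m p + q' *m q = 1%:M].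
Proof.
move=> <-{n}.
exists (row_mx 1%:M 0), (col_mx 1%:M 0), (row_mx 0 1%:M), (col_mx 0 1%:M); split.
- by rewrite pid_mx_row.
- by rewrite mul_row_col mul0mx addr0 mul1mx.
- by rewrite mul_row_col mul0mx add0r mul1mx.
- by rewrite mul_row_col mul0mx addr0 mulmx0.
split; first by rewrite mul_row_col mul0mx add0r mulmx0.
rewrite !mul_col_row !mul1mx !mul0mx.
by rewrite add_block_mx !addr0 !add0r -scalar_mx_block.
Qed.

(** The first rows of [row_ebase (U i)] span [U i] and the others a complement,
    so the coordinate splitting conjugated by this matrix does the job. *)
Lemma splitting_subspaces d e f (U : subspaces F d) :
  (forall i, \rank (U i) = e i) -> (forall i, (e i + f i)%N = d i) ->
  exists s : splitting d e f, forall i, (spl_in s i :=: U i)%MS.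
Proof.
move=> rU dE.
pose P i (x : 'M[F]_(e i, d i) * 'M[F]_(d i, e i) * 'M[F]_(f i, d i) * 'M[F]_(d i, f i)) :=
  [/\ x.1.1.1 = pid_mx (e i), x.1.1.1 *m x.1.1.2 = 1%:M, x.1.2 *m x.2 = 1%:M,
   x.1.1.1 *m x.2 = 0 & x.1.2 *m x.1.1.2 = 0 /\ x.1.1.2 *m x.1.1.1 + x.2 *m x.1.2 = 1%:M].
have /all_sig[g gP] : forall i, {x | P i x}.
  move=> i; apply: cid; have [p [p' [q [q' [h0 h1 h2 h3 [h4 h5]]]]]] := splitting_mx (dE i).
  by exists (p, p', q, q').
pose E i := row_ebase (U i).
have EK i : E i *m invmx (E i) = 1%:M by rewrite mulmxV // row_ebase_unit.
have KE i : invmx (E i) *m E i = 1%:M by rewrite mulVmx // row_ebase_unit.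
have cK m n i (A : 'M_(m, d i)) (B : 'M_(d i, n)) :
    (A *m E i) *m (invmx (E i) *m B) = A *m B.
  by rewrite -mulmxA (mulmxA (E i)) EK mul1mx.
pose p i := (g i).1.1.1 *m E i; pose p' i := invmx (E i) *m (g i).1.1.2.
pose q i := (g i).1.2 *m E i; pose q' i := invmx (E i) *m (g i).2.
have pK i : p i *m p' i = 1%:M by rewrite cK; case: (gP i).
have qK i : q i *m q' i = 1%:M by rewrite cK; case: (gP i).
have pq' i : p i *m q' i = 0 by rewrite cK; case: (gP i).
have qp' i : q i *m p' i = 0 by rewrite cK; case: (gP i) => _ _ _ _ [].
have pqK i : p' i *m p i + q' i *m q i = 1%:M.
  case: (gP i) => _ _ _ _ [_ sumE].
  by rewrite /p /p' /q /q' -!mulmxA -mulmxDr !mulmxA -mulmxDl sumE mul1mx KE.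
exists (Splitting (fun i => esym (dE i)) pK qK pq' qp' pqK) => i /=.
rewrite /p; case: (gP i) => -> _ _ _ _; rewrite -rU.
by move: (eq_row_base (U i)); rewrite /row_base.
Qed.

Section SubQuotient.
Variables (d e f : dimvec Q) (s : splitting d e f) (M : rep F d).

Definition subrep_of : rep F e := fun a => spl_in s (source a) *m M a *m spl_out s (target a).
Definition quotrep_of : rep F f := fun a => spl_in' s (source a) *m M a *m spl_out' s (target a).

Hypothesis stable : forall a, (spl_in s (source a) *m M a <= spl_in s (target a))%MS.


Lemma spl_in_outK m i (A : 'M[F]_(m, d i)) :
  (A <= spl_in s i)%MS -> A *m spl_out s i *m spl_in s i = A.
Proof. by move=> /submxP[D ->]; rewrite -!mulmxA (mulmxA (spl_in s i)) spl_inK mul1mx. Qed.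

Lemma spl_in_out0 m i (A : 'M[F]_(m, d i)) :
  (A <= spl_in s i)%MS -> A *m spl_out' s i = 0.
Proof. by move=> /submxP[D ->]; rewrite -mulmxA spl_in0 mulmx0. Qed.

(** Subrepresentations of the sub are subrepresentations of [M], and those of
    the quotient have preimages in [M] whose weight differs by
    [weight theta e = 0]. *)
Lemma semistable_sub_quot theta :
  semistable theta M -> weight theta e = 0 ->
  semistable theta subrep_of /\ semistable theta quotrep_of.
Proof.
move=> sst we; split; apply/weight_dim_leP; split=> //.
- move=> U sU; rewrite (@eq_weight _ _ _ _ (fun i => \rank (U i *m spl_in s i))); last first.
    move=> i; rewrite /dim_subspaces mxrankMfree //.
    by apply/row_freeP; exists (spl_out s i); rewrite spl_inK.
  apply: semistable_subrep sst _ => a.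
  rewrite -mulmxA -(spl_in_outK (stable a)) mulmxA.
  by rewrite submxMr // sU.
- by case: sst => + _; rewrite (weight_add _ (spl_dim s)) we add0r.
move=> U sU; rewrite -[X in X <= 0]add0r -{1}we -(@weight_add _ _ _ (fun i => e i + \rank (U i))%N) //.
rewrite (@eq_weight _ _ _ _
    (fun i => \rank (col_mx (spl_in s i) (U i *m spl_in' s i)))).
  apply: semistable_subrep sst _ => a.
  rewrite mul_col_mx col_mx_sub; apply/andP; split.
    by rewrite (submx_trans (stable a)) // -addsmxE addsmxSl.
  rewrite -[X in (X <= _)%MS]mulmx1 -(spl_outK s) mulmxDr -addsmxE addmx_sub_adds //.
    by rewrite mulmxA submxMl.
  rewrite mulmxA -2!(mulmxA (U _)) submxMr //; exact: sU.
move=> i; have free : row_free (row_mx (spl_out s i) (spl_out' s i)).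
  by apply/row_freeP; exists (col_mx (spl_in s i) (spl_in' s i)); rewrite mul_row_col spl_outK.
rewrite -(mxrankMfree _ free) mul_col_row spl_inK spl_in0 -!mulmxA spl_inK' spl_in0'.
by rewrite mulmx0 mulmx1 rank_diag_block_mx mxrank1.
Qed.

(** A subrepresentation [U] is an extension of its image in the quotient by its
    intersection with the sub. *)
Lemma semistable_ext theta :
  semistable theta subrep_of -> semistable theta quotrep_of -> semistable theta M.
Proof.
move=> ssts sstq; apply/weight_dim_leP; split=> [|U sU].
  by rewrite (weight_add _ (spl_dim s)); case: ssts sstq => -> _ [-> _]; rewrite addr0.
rewrite (@weight_add _ _ _ _ (fun i => \rank ((U i :&: spl_in s i)%MS *m spl_out s i))
  (fun i => \rank (U i *m spl_out' s i))); last first.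
  move=> i; rewrite /dim_subspaces -(mxrank_mul_ker (U i) (spl_out' s i)) addnC; congr (_ + _)%N.
  have /eqmxP kerE : (kermx (spl_out' s i) == spl_in s i)%MS.
    apply/andP; split; last by apply/sub_kermxP; rewrite spl_in0.
    rewrite -[X in (X <= _)%MS]mulmx1 -(spl_outK s) mulmxDr.
    by rewrite !mulmxA mulmx_ker mul0mx addr0 submxMl.
  rewrite (cap_eqmx (eqmx_refl (U i)) kerE); apply/eqP; rewrite eqn_leq mxrankM_maxl andbT.
  by rewrite -{1}(spl_in_outK (capmxSr (U i) (spl_in s i))) mxrankM_maxl.
rewrite -[leRHS]addr0 lerD //.
  apply: semistable_subrep ssts _ => a.
  rewrite !mulmxA (spl_in_outK (capmxSr _ _)) submxMr // sub_capmx.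
  rewrite (submx_trans _ (sU a)) ?submxMr ?capmxSl //.
  by rewrite (submx_trans _ (stable a)) ?submxMr ?capmxSr.
apply: semistable_subrep sstq _ => a.
have /(canRL (addKr _)) oq := spl_outK s (source a).
rewrite !mulmxA -(mulmxA (U _)) oq -!mulmxA mulmxDl mul1mx mulNmx -!mulmxA.
by rewrite (mulmxA (spl_in s _)) spl_in_out0 // mulmx0 oppr0 add0r mulmxA submxMr.
Qed.

End SubQuotient.
End Semistable.

(** * Polynomial representations and their sublattices *)

Section PolynomialMatrices.
Variable F : fieldType.

Definition at0 m n (A : 'M[{poly F}]_(m, n)) : 'M[F]_(m, n) := map_mx (horner_eval 0) A.

Lemma at0M m n p (A : 'M[{poly F}]_(m, n)) (B : 'M_(n, p)) : at0 (A *m B) = at0 A *m at0 B.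
Proof. exact: map_mxM. Qed.

Lemma at0_cst m n (A : 'M[F]_(m, n)) : at0 (map_mx polyC A) = A.
Proof. by apply/matrixP => i j; rewrite !mxE horner_evalE hornerC. Qed.

Lemma at0X m n (A : 'M[{poly F}]_(m, n)) : at0 ('X *: A) = 0.
Proof. by apply/matrixP => i j; rewrite !mxE horner_evalE hornerM hornerX mul0r. Qed.

Lemma at0D m n (A B : 'M[{poly F}]_(m, n)) : at0 (A + B) = at0 A + at0 B.
Proof. exact: map_mxD. Qed.

Lemma at0_eq0 m n (A : 'M[{poly F}]_(m, n)) : at0 A = 0 -> exists A', A = 'X *: A'.
Proof.
move=> A0; exists (map_mx (drop_poly 1) A); apply/matrixP => i j; rewrite !mxE.
apply/polyP => l; rewrite coefXM coef_drop_poly.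
case: l => [|l] /=; last by rewrite addn1.
have := congr1 (fun B : 'M_(_, _) => B i j) A0.
by rewrite !mxE horner_evalE horner_coef0.
Qed.

Lemma scaleX_inj m n : injective (fun A : 'M[{poly F}]_(m, n) => 'X *: A).
Proof.
move=> A B /matrixP eAB; apply/matrixP => i j.
by have := eAB i j; rewrite !mxE; apply: mulfI; rewrite polyX_eq0.
Qed.

(** [dilation n r] is the diagonal matrix with entries [1] ([r] times), then
    [X]; [codilation n r] is [X] times its inverse. *)
Definition dilation n r : 'M[{poly F}]_n := pid_mx r + 'X *: copid_mx r.
Definition codilation n r : 'M[{poly F}]_n := 'X *: pid_mx r + copid_mx r.

Lemma pid_mx_cst m n r : map_mx polyC (pid_mx r : 'M[F]_(m, n)) = pid_mx r.
Proof. exact: map_pid_mx. Qed.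

Lemma copid_mx_cst n r : map_mx polyC (copid_mx r : 'M[F]_n) = copid_mx r.
Proof. exact: map_copid_mx. Qed.

Lemma codilationK n r : (r <= n)%N -> codilation n r *m dilation n r = 'X%:M.
Proof.
move=> le_rn; rewrite /dilation /codilation mulmxDl !(mulmxDr _ (pid_mx r)).
rewrite -!scalemxAl -!scalemxAr mul_pid_mx_copid // mul_copid_mx_pid //.
rewrite copid_mx_id // pid_mx_id // !scaler0 addr0 add0r -scalerDr addrC subrK.
by rewrite scalemx1.
Qed.

Lemma det_dilation n r : (r <= n)%N -> \det (dilation n r) = 'X^(n - r).
Proof.
move=> le_rn.
have -> : dilation n r = diag_mx (\row_j (if (j < r)%N then 1 else 'X)).
  apply/matrixP => i j; rewrite !mxE.
  case: (eqVneq i j) => [<-|neq]; rewrite /= ?eqxx /=; last first.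
    by rewrite -[val i == val j]/(i == j) (negPf neq) /= mulr0n subr0 mulr0 addr0.
  by case: ltnP; rewrite /= ?subrr ?mulr0 ?addr0 ?subr0 ?mulr1 ?add0r.
rewrite det_diag; under eq_bigr do rewrite mxE.
rewrite -(big_mkord xpredT (fun j => if (j < r)%N then 1 else 'X)) (big_cat_nat _ le_rn) //=.
rewrite big_nat big1 => [|j /andP[_ ->] //]; rewrite mul1r.
rewrite big_nat (eq_bigr (fun=> 'X)) => [|j /andP[rj _]]; last by rewrite ltnNge rj.
by rewrite -big_nat prodr_const_nat.
Qed.

End PolynomialMatrices.

Section Lattices.
Variables (F : fieldType) (Q : quiver) (d : dimvec Q).

Definition polyrep := forall a : arrow Q, 'M[{poly F}]_(d (source a), d (target a)).
Definition lattice := forall i : vertex Q, 'M[{poly F}]_(d i).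
Implicit Types (M N : polyrep) (B G : lattice).

Definition fibre0 M : rep F d := fun a => at0 (M a).

(** When the [B i] are nonsingular this says that their row spaces form a
    sublattice of [M], and that [N] is [M] written in the bases [B]. *)
Definition intertwines B N M : Prop :=
  forall a, B (source a) *m M a = N a *m B (target a).

(** [G] is the lattice of the vectors of [N] whose value at [X = 0] lies in
    [U]: in a basis adapted to [U] it is a dilation.  It is stable under [N]
    because the matrix of [fibre0 N] in such a basis is block triangular, so
    that the only entries to be divided by [X] vanish at [0]. *)
Lemma elementary_modification N (U : subspaces F d) : subrep (fibre0 N) U ->
  exists G N', intertwines G N' N /\
    forall i, (at0 (G i) :=: U i)%MS /\
      exists2 c : F, c != 0 & \det (G i) = c *: 'X^(d i - \rank (U i)).
Proof.
move=> sU; pose r i := \rank (U i); pose E i := row_ebase (U i).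
have r_le i : (r i <= d i)%N by exact: rank_leq_row.
pose Ep i : 'M[{poly F}]_(d i) := map_mx polyC (E i).
pose Ei i : 'M[{poly F}]_(d i) := map_mx polyC (invmx (E i)).
have EiK i : Ei i *m Ep i = 1%:M.
  by rewrite -map_mxM mulVmx ?row_ebase_unit // map_mx1.
pose A a := Ep (source a) *m N a *m Ei (target a).
pose D i := dilation F (d i) (r i); pose D' i := codilation F (d i) (r i).
have UE i : ((pid_mx (r i) : 'M_(d i)) *m E i :=: U i)%MS.
  apply: eqmx_sym; have := @eqmxMfull _ _ _ _ (col_ebase (U i)) (pid_mx (r i) *m E i).
  by rewrite mulmxA mulmx_ebase row_full_unit col_ebase_unit => /(_ isT).
have /fin_all_exists[N' N'E] : forall a, exists N'a,
    D (source a) *m A a *m D' (target a) = 'X *: N'a.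
  move=> a; apply: at0_eq0.
  rewrite !at0M.
  have -> : at0 (D (source a)) = pid_mx (r (source a)).
    by rewrite at0D at0X addr0 -pid_mx_cst at0_cst.
  have -> : at0 (D' (target a)) = copid_mx (r (target a)).
    by rewrite at0D at0X add0r -copid_mx_cst at0_cst.
  rewrite !at0_cst.
  have /submxP[W WE] :
      ((pid_mx (r (source a)) : 'M_(d (source a))) *m E (source a) *m at0 (N a) <=
       (pid_mx (r (target a)) : 'M_(d (target a))) *m E (target a))%MS.
    by rewrite UE (eqmxMr _ (UE _)); exact: sU.
  rewrite !mulmxA WE -!mulmxA (mulmxA (E _)) mulmxV ?row_ebase_unit // mul1mx.
  by rewrite mul_pid_mx_copid // mulmx0.
exists (fun i => D i *m Ep i), N'; split=> [a|i].
  apply: (@scaleX_inj _ _ _).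
  rewrite /= [RHS]scalemxAl -N'E -(mulmxA _ (D' _)) (mulmxA (D' _)) codilationK //.
  rewrite mul_scalar_mx -scalemxAr; congr ('X *: _).
  by rewrite /A -!mulmxA EiK mulmx1.
split; last first.
  exists (\det (E i)); first by have := row_ebase_unit (U i); rewrite unitmxE unitfE.
  by rewrite det_mulmx det_dilation // det_map_mx mulrC mul_polyC.
rewrite at0M at0_cst (_ : at0 (D i) = pid_mx (r i)); first exact: UE.
by rewrite at0D at0X addr0 -pid_mx_cst at0_cst.
Qed.

Definition colength B : dimvec Q := fun i => (size (\det (B i))).-1.
(** The cokernel of [B] is killed by a power of [X]: the two lattices differ at
    the origin only. *)
Definition supported_at0 B : Prop := exists m, forall i, \det (B i) %| 'X^m.

Lemma degM (p q : {poly F}) : p != 0 -> q != 0 ->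
  (size (p * q)).-1 = ((size p).-1 + (size q).-1)%N.
Proof.
move=> p0 q0; rewrite size_mul //.
move: p0 q0; rewrite -!size_poly_gt0; case: (size p) => // a; case: (size q) => // b _ _.
by rewrite addnS.
Qed.

Lemma dvdp_Xn_neq0 (p : {poly F}) m : p %| 'X^m -> p != 0.
Proof. by apply: contraTneq => ->; rewrite dvd0p monic_neq0 ?monicXn. Qed.

Lemma intertwines_comp M N N' B G :
  intertwines B N M -> intertwines G N' N ->
  intertwines (fun i => G i *m B i) N' M.
Proof. by move=> BN GN a; rewrite -mulmxA BN mulmxA GN mulmxA. Qed.

Lemma colength_comp B G i : \det (B i) != 0 -> \det (G i) != 0 ->
  colength (fun i => G i *m B i) i = (colength G i + colength B i)%N.
Proof. by move=> B0 G0; rewrite /colength det_mulmx degM. Qed.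

Lemma supported_at0_comp B G : supported_at0 B -> supported_at0 G ->
  supported_at0 (fun i => G i *m B i).
Proof.
move=> [m hm] [n hn]; exists (n + m)%N => i.
by rewrite det_mulmx exprD dvdp_mul.
Qed.

Lemma colength_modification (U : subspaces F d) G :
  (forall i, exists2 c : F, c != 0 & \det (G i) = c *: 'X^(d i - \rank (U i))) ->
  supported_at0 G /\ forall i, colength G i = (d i - \rank (U i))%N.
Proof.
move=> detG; split=> [|i]; last first.
  by have [c c0] := detG i; rewrite /colength => ->; rewrite size_scale // size_polyXn.
exists (\sum_i d i)%N => i; have [c c0 ->] := detG i.
rewrite dvdpZl // dvdp_exp2l // (bigD1 i) //=.
by rewrite (leq_trans (leq_subr _ _)) ?leq_addr.
Qed.

Variables (R : realType) (theta : vertex Q -> R).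

(** By induction on the colength.  If [B] is not invertible at [0], the
    preimage in [N] of the kernel of [at0 B : fibre0 N -> fibre0 M] is a
    lattice that [B] maps into [X M]; dividing by [X] gives a lattice [B']
    between [N] and [M].  The weight drops by that of the kernel, which is
    nonnegative since the image is a subrepresentation of the semistable
    [fibre0 M]. *)
Lemma colength_ge0 B N M : semistable theta (fibre0 M) ->
  intertwines B N M -> supported_at0 B -> 0 <= weight theta (colength B).
Proof.
move=> sst; have [n] := ubnP (\sum_i colength B i)%N.
elim: n => // n IHn in B N * => ltBn BN [m Bm].
have detB0 i := dvdp_Xn_neq0 (Bm i).
pose U i := kermx (at0 (B i)).
have sU : subrep (fibre0 N) U.
  by move=> a; apply/sub_kermxP; rewrite -mulmxA -at0M -BN at0M mulmxA mulmx_ker mul0mx.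
have rU i : (\rank (U i) + \rank (at0 (B i)))%N = d i.
  by rewrite mxrank_ker subnK // rank_leq_row.
have wU : 0 <= weight theta (fun i => \rank (U i)).
  have : weight theta (fun i => \rank (at0 (B i))) <= 0.
    by apply: semistable_subrep sst _ => a; rewrite -at0M BN at0M submxMl.
  have := weight_add theta (fun i => esym (rU i)); case: sst => -> _; lra.
(* Without kernels, the determinants are powers of [X] that do not vanish at [0]. *)
have [U0|/forallPn[i0 Ui0]] := boolP [forall i, U i == 0].
  rewrite /weight big1 // => i _; have /eqP Ui := forallP U0 i.
  have : \det (B i) %| 'X^m * 1 by rewrite mulr1.
  rewrite Gauss_dvdpr; first by rewrite dvdp1 /colength => /eqP ->; rewrite mulr0.
  rewrite coprimep_expr // coprimepX; apply/negP => /rootP detBi0.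
  have := rU i; rewrite Ui mxrank0 add0n => /eqP.
  rewrite -[_ == _]/(row_free _) row_free_unit unitmxE unitfE => /eqP; apply.
  by rewrite det_map_mx.
have [G [N' [GN' GU]]] := elementary_modification sU.
have [[m' Gm'] Gcol] := colength_modification (fun i => (GU i).2).
have detG0 i := dvdp_Xn_neq0 (Gm' i).
have /fin_all_exists[B' B'E] : forall i, exists B'i, G i *m B i = 'X *: B'i.
  move=> i; apply: at0_eq0; rewrite at0M; apply/sub_kermxP.
  by rewrite (GU i).1.
have B'N' : intertwines B' N' M.
  move=> a; apply: scaleX_inj.
  by rewrite /= scalemxAl -B'E scalemxAr -B'E; apply: intertwines_comp GN' _.
have detB' i : 'X^(d i) * \det (B' i) = \det (G i) * \det (B i).
  by rewrite -detZ -B'E det_mulmx.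
have detB'0 i : \det (B' i) != 0.
  have : 'X^(d i) * \det (B' i) != 0 by rewrite detB' mulf_neq0.
  by rewrite mulf_eq0 negb_or => /andP[].
have colB i : colength B i = (colength B' i + \rank (U i))%N.
  have /(congr1 (fun p : {poly F} => (size p).-1)) := detB' i.
  have X0 : 'X^(d i) != 0 :> {poly F} by rewrite monic_neq0 ?monicXn.
  rewrite !degM // size_polyXn /= -/(colength G i) Gcol.
  rewrite -/(colength B' i) -/(colength B i).
  by have := rank_leq_row (U i); move: (\rank _) => r; lia.
rewrite (weight_add _ colB) addr_ge0 //; apply: (IHn B' N') => //.
  rewrite -ltnS (leq_trans _ ltBn) // ltnS (eq_bigr _ (fun i _ => colB i)) big_split /=.
  rewrite -[X in (X < _)%N]addn0 ltn_add2l (bigD1 i0) //= ltn_addr //.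
  by rewrite lt0n mxrank_eq0.
exists (m' + m)%N => i; rewrite exprD (dvdp_trans _ (dvdp_mul (Gm' i) (Bm i))) //.
by rewrite -detB' dvdp_mull.
Qed.

(** [B' = X^m B^-1] embeds [M] into [N] for [m] large. *)
Lemma dual_lattice B N M : intertwines B N M -> supported_at0 B ->
  exists2 B', intertwines B' M N /\ supported_at0 B' &
    exists m, forall i, (colength B' i + colength B i)%N = (m * d i)%N.
Proof.
move=> BN [m Bm]; have detB0 i := dvdp_Xn_neq0 (Bm i).
pose B' i := ('X^m %/ \det (B i)) *: \adj (B i).
have B'B i : B' i *m B i = 'X^m%:M.
  by rewrite -scalemxAl mul_adj_mx scale_scalar_mx divpK.
have BB' i : B i *m B' i = 'X^m%:M.
  by rewrite -scalemxAr mul_mx_adj scale_scalar_mx divpK.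
have detBB' i : \det (B' i) * \det (B i) = 'X^(m * d i).
  by rewrite -det_mulmx B'B det_scalar exprM.
exists B'; last exists m.
  split=> [a|]; last first.
    exists (m * \sum_i d i)%N => i; rewrite (dvdp_trans (dvdp_mulr (\det (B i)) (dvdpp _))) //.
    by rewrite detBB' dvdp_exp2l // leq_mul2l (bigD1 i) //= leq_addr orbT.
  have := congr1 (fun A => B' (source a) *m A *m B' (target a)) (BN a).
  rewrite /= !mulmxA B'B -!mulmxA BB' mul_scalar_mx !mulmxA mul_mx_scalar -scalemxAl.
  move=> /matrixP eq; apply/matrixP => i j; have := eq i j; rewrite !mxE => /esym.
  by apply: mulfI; rewrite monic_neq0 ?monicXn.
move=> i; rewrite -degM ?detBB' ?size_polyXn //.
have : 'X^(m * d i) != 0 :> {poly F} by rewrite monic_neq0 ?monicXn.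
by rewrite -detBB' mulf_eq0 negb_or => /andP[].
Qed.

Lemma colength_le0 B N M : semistable theta (fibre0 N) ->
  intertwines B N M -> supported_at0 B -> weight theta (colength B) <= 0.
Proof.
move=> sst BN B0; have [B' [B'M B'0] [m colB']] := dual_lattice BN B0.
have := colength_ge0 sst B'M B'0.
have := weight_add theta (fun i => esym (colB' i)).
by rewrite weight_mull; case: sst => -> _; rewrite mulr0; lra.
Qed.

End Lattices.

(** * Row-reduced polynomial matrices *)

Section RowReduction.
Variable F : fieldType.

Lemma coefM_top (p q : {poly F}) a b : (size p <= a.+1)%N -> (size q <= b.+1)%N ->
  (p * q)`_(a + b) = p`_a * q`_b.
Proof.
move=> sp sq; have lt_a : (a < (a + b).+1)%N by rewrite ltnS leq_addr.
rewrite coefM (bigD1 (Ordinal lt_a)) //= addKn big1 ?addr0 // => -[j /= ltj] neq.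
have {neq} : j != a by [].
rewrite neq_ltn => /orP[lt_ja|lt_aj].
  by rewrite [q`__]nth_default ?mulr0 // (leq_trans sq) //; lia.
by rewrite nth_default ?mul0r // (leq_trans sp).
Qed.

Lemma coef_prod_top (I : eqType) (r : seq I) (f : I -> {poly F}) (a : I -> nat) :
  (forall i, size (f i) <= (a i).+1)%N ->
  (size (\prod_(i <- r) f i)%R <= (\sum_(i <- r) a i).+1)%N /\
  (\prod_(i <- r) f i)`_(\sum_(i <- r) a i) = \prod_(i <- r) (f i)`_(a i).
Proof.
move=> sf; elim: r => [|i r [IHs IHc]]; first by rewrite !big_nil size_poly1 coef1.
rewrite !big_cons coefM_top // IHc; split=> //.
rewrite (leq_trans (size_polyMleq _ _)) //; have := sf i; lia.
Qed.

Variable n : nat.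
Implicit Types (C : 'M[{poly F}]_n) (rho : 'I_n -> nat).

(** The [rho j] are only bounds; they are the degrees of the rows as soon as
    the matrix [lead_mx] of the corresponding coefficients is invertible, in
    which case the matrix is called row reduced. *)
Definition row_degrees C rho : Prop := forall j l, (size (C j l) <= (rho j).+1)%N.

Definition lead_mx C rho : 'M[F]_n := \matrix_(j, l) (C j l)`_(rho j).

Lemma size_det_row_degrees C rho : row_degrees C rho ->
  (size (\det C)%R <= (\sum_j rho j).+1)%N /\
  (\det C)`_(\sum_j rho j) = \det (lead_mx C rho).
Proof.
move=> Crho; have prodP (s : {perm 'I_n}) := @coef_prod_top _ (index_enum _)
  (fun j => C j (s j)) rho (fun j => Crho j (s j)).
split.
  rewrite /determinant (leq_trans (size_sum _ _ _)) //; apply/bigmax_leqP => s _.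
  by rewrite -signr_odd mulr_sign; case: ifP; rewrite ?size_polyN (prodP s).1.
rewrite /determinant coef_sum; apply: eq_bigr => s _.
rewrite [in RHS](eq_bigr (fun j => (C j (s j))`_(rho j))) => [|j _]; last by rewrite mxE.
by rewrite -(prodP s).2 -signr_odd -[in RHS]signr_odd !mulr_sign; case: ifP; rewrite ?coefN.
Qed.

Lemma size_det_row_reduced C rho : row_degrees C rho -> lead_mx C rho \in unitmx ->
  size (\det C) = (\sum_j rho j).+1.
Proof.
move=> /size_det_row_degrees[szC coefC]; rewrite unitmxE unitfE -coefC => nz.
by apply/eqP; rewrite eqn_leq szC ltnNge; apply: contraNN nz => /leq_sizeP ->.
Qed.

(** A linear relation between the leading rows allows to lower the degree of
    the row of largest [rho j] among those it involves, by adding multiples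
    [X^(rho j - rho b)] of the others. *)
Lemma row_reduction C rho : row_degrees C rho -> \det C != 0 ->
  exists V rho', [/\ V \in unitmx, row_degrees (V *m C) rho'
    & lead_mx (V *m C) rho' \in unitmx].
Proof.
have [m] := ubnP (\sum_j rho j)%N.
elim: m => // m IHm in C rho * => lt_rho Crho detC.
have [lu|] := boolP (lead_mx C rho \in unitmx).
  by exists 1%:M, rho; rewrite unitmx1 mul1mx.
rewrite unitmxE unitfE negbK => /det0P[v v0 vlead].
have /rV0Pn[j0 vj0] := v0.
case: (@arg_maxnP _ j0 (fun j => v 0 j != 0) rho vj0) => j vj jmax.
pose T : 'M[{poly F}]_n :=
  \matrix_(a, b) if a == j then (v 0 b)%:P * 'X^(rho j - rho b) else (a == b)%:R.
have detT : \det T = (v 0 j)%:P.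
  rewrite (expand_det_col _ j) (bigD1 j) //= big1 => [|a /negPf aj]; last first.
    by rewrite mxE aj mul0r.
  rewrite mxE eqxx subnn mulr1 addr0 /cofactor addnn -signr_odd odd_double mul1r.
  suff -> : row' j (col' j T) = 1%:M by rewrite det1 mulr1.
  apply/matrixP => a b; rewrite !mxE eq_sym (negPf (neq_lift _ _)).
  by rewrite (inj_eq lift_inj).
have Tu : T \in unitmx by rewrite unitmxE detT poly_unitE size_polyC vj coefC eqxx unitfE.
have TCj l : (T *m C) j l = \sum_b ((v 0 b)%:P * 'X^(rho j - rho b)) * C b l.
  by rewrite mxE; apply: eq_bigr => b _; rewrite mxE eqxx.
have TCa a l : a != j -> (T *m C) a l = C a l.
  move=> aj; rewrite mxE (bigD1 a) //= big1 => [|b ba]; rewrite mxE (negPf aj).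
    by rewrite eqxx mul1r addr0.
  by rewrite eq_sym (negPf ba) mul0r.
have szv b : (size ((v 0 b)%:P * 'X^(rho j - rho b))%R <= (rho j - rho b).+1)%N.
  rewrite (leq_trans (size_polyMleq _ _)) // size_polyXn size_polyC.
  by case: (_ != _); lia.
have vrho b : v 0 b != 0 -> (rho j = (rho j - rho b) + rho b)%N.
  by move=> vb; rewrite subnK //; apply: jmax.
have szTC l : (size ((T *m C)%R j l) <= rho j)%N.
  rewrite TCj; apply/leq_sizeP => c; rewrite leq_eqVlt coef_sum => /orP[/eqP <-|lt_c].
    have /rowP/(_ l) := vlead; rewrite !mxE => vl0; rewrite -[RHS]vl0; apply: eq_bigr => b _.
    rewrite !mxE; have [->|vb] := eqVneq (v 0 b) 0; first by rewrite !mul0r coef0.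
    rewrite {2}(vrho _ vb) coefM_top // coefMXn ltnn subnn coefC eqxx.
    by [].
  apply: big1 => b _; have [->|vb] := eqVneq (v 0 b) 0; first by rewrite !mul0r coef0.
  rewrite nth_default // (leq_trans (size_polyMleq _ _)) //.
  have := szv b; have := Crho b l; have := vrho _ vb; move: lt_c.
  by move: (rho j) (rho b) (size _) (size _) => rj rb s1 s2; lia.
pose rho' a := if a == j then (rho j).-1 else rho a.
have rho_gt0 : (0 < rho j)%N.
  rewrite lt0n; apply: contra_neq detC => rho0.
  suff : \det (T *m C) = 0.
    move/eqP; rewrite det_mulmx mulf_eq0 detT polyC_eq0 (negPf vj) => /eqP; exact.
  rewrite (expand_det_row _ j) big1 // => l _.
  by have := szTC l; rewrite rho0 leqn0 size_poly_eq0 => /eqP ->; rewrite mul0r.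
have [|||V [rho'' [Vu h1 h2]]] := IHm (T *m C) rho'.
- rewrite -ltnS (leq_trans _ lt_rho) // ltnS (bigD1 j) //= [X in (_ < X)%N](bigD1 j) //=.
  rewrite /rho' eqxx (eq_bigr rho) => [|a /negPf -> //].
  by rewrite ltn_add2r prednK.
- move=> a l; rewrite /rho'; case: (eqVneq a j) => [->|aj]; last by rewrite TCa.
  by rewrite prednK.
- by rewrite det_mulmx detT mulf_neq0 // polyC_eq0.
exists (V *m T), rho''; rewrite -mulmxA; split=> //.
by rewrite unitmx_mul Vu.
Qed.

(** In a combination of the rows of a row-reduced matrix, the terms of highest
    degree cannot cancel. *)
Lemma predictable_degree C rho (w : 'I_n -> {poly F}) D :
  row_degrees C rho -> lead_mx C rho \in unitmx ->
  (forall l, (size (\sum_j w j * C j l)%R <= D.+1)%N) ->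
  forall j, w j != 0 -> (size (w j) + rho j <= D.+1)%N.
Proof.
move=> Crho leadu szw j0 wj0.
case: (@arg_maxnP _ j0 (fun j => w j != 0) (fun j => size (w j) + rho j)%N wj0) => j wj jmax.
rewrite (leq_trans (jmax _ wj0)) // leqNgt; apply/negP => ltD.
pose E := (size (w j) + rho j).-1.
have sE : (size (w j) + rho j = E.+1)%N by rewrite prednK //; lia.
pose v : 'rV[F]_n := \row_b (w b)`_(E - rho b).
have : v *m lead_mx C rho = 0.
  apply/rowP => l; rewrite !mxE -[RHS](_ : (\sum_b w b * C b l)`_E = 0); last first.
    by rewrite nth_default // (leq_trans (szw l)) //; lia.
  rewrite coef_sum; apply: eq_bigr => b _; rewrite !mxE.
  have [->|wb] := eqVneq (w b) 0; first by rewrite mul0r !coef0 mul0r.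
  have le_b : (size (w b) + rho b <= E.+1)%N by rewrite -sE; apply: jmax.
  have := wb; rewrite -size_poly_gt0 => wb_gt0.
  have {2}-> : E = (E - rho b + rho b)%N.
    by rewrite subnK //; move: le_b wb_gt0; move: (rho b) (size _) => rb s1; lia.
  by rewrite coefM_top //; move: le_b wb_gt0; move: (rho b) (size _) => rb s1; lia.
move/(congr1 (mulmx^~ (invmx (lead_mx C rho)))); rewrite /= mulmxK // mul0mx.
move/rowP/(_ j); rewrite !mxE => /eqP.
have -> : (E - rho j = (size (w j)).-1)%N by lia.
by rewrite -lead_coefE lead_coef_eq0 (negPf wj).
Qed.

End RowReduction.

Lemma rank_partial_diag (F : fieldType) n (P : pred 'I_n) :
  \rank (diag_mx (\row_j (P j)%:R) : 'M[F]_n) = #|P|.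
Proof.
have le (S : pred 'I_n) : (\rank (diag_mx (\row_j (S j)%:R) : 'M[F]_n) <= #|S|)%N.
  have -> : diag_mx (\row_j (S j)%:R) = \sum_(j in S) delta_mx j j :> 'M[F]_n.
    apply/matrixP => a b; rewrite !mxE summxE; have [<-|ab] := eqVneq a b.
      rewrite mulr1n; have [Sa|Sa] := boolP (S a).
        rewrite (bigD1 a) //= big1 => [|c /andP[_ ca]]; rewrite mxE ?eqxx ?addr0 //.
        by rewrite eq_sym (negPf ca).
      rewrite big1 // => c Sc; rewrite mxE; case: eqVneq => // eac.
      by move: Sc; rewrite unfold_in -eac (negPf Sa).
    rewrite mulr0n big1 // => c _; rewrite mxE; case: eqVneq => // eac.
    by rewrite -eac eq_sym (negPf ab) andbF.
  rewrite -sum1_card; elim/big_ind2: _ => [|A a B b hA hB|j _]; first by rewrite mxrank0.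
    by rewrite (leq_trans (mxrank_add _ _)) // leq_add.
  by rewrite mxrank_delta.
apply/eqP; rewrite eqn_leq le /= -(leq_add2r #|predC P|) cardC card_ord.
rewrite -{1}(mxrank1 F n) (leq_trans _ (leq_add (leqnn _) (le (predC P)))) //.
rewrite (leq_trans _ (mxrank_add _ _)) // eq_leq //; congr (\rank _).
apply/matrixP => a b; rewrite !mxE -mulrnDl /=.
by case: (P a); rewrite ?addr0 ?add0r.
Qed.

(** * Lattices in a pencil have bounded weight *)

Section Pencil.
Variables (F : fieldType) (Q : quiver) (d : dimvec Q) (M0 M1 : rep F d).

Definition pencil : polyrep F d :=
  fun a => map_mx polyC (M0 a) + 'X *: map_mx polyC (M1 a).

Lemma fibre0_pencil : fibre0 pencil = M0.
Proof.
apply: functional_extensionality_dep => a.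
by rewrite /fibre0 at0D at0X addr0 at0_cst.
Qed.

Lemma coef_mul_pencil m a (C : 'M[{poly F}]_(m, d (source a))) j l e :
  ((C *m pencil a) j l)`_e.+1 =
  \sum_b ((C j b)`_e.+1 * M0 a b l + (C j b)`_e * M1 a b l).
Proof.
rewrite mxE coef_sum; apply: eq_bigr => b _.
by rewrite !mxE mulrDr coefD coefMC mulrCA coefXM /= coefMC.
Qed.

(** [C] is a row-reduced basis of a lattice of the pencil.  Since the
    coefficient of [X] in the pencil is [M1], leading coefficients at infinity
    are transformed by [M1]. *)
Section LeadingSpaces.
Variables (C : lattice F d) (A : polyrep F d) (rho : forall i, 'I_(d i) -> nat).
Hypothesis (CA : intertwines C A pencil).
Hypothesis (Crho : forall i, row_degrees (C i) (@rho i)).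
Hypothesis (leadu : forall i, lead_mx (C i) (@rho i) \in unitmx).

(** The coefficients of [X^c] in the elements of degree at most [c] of the
    lattice. *)
Definition leading_space (c : nat) (i : vertex Q) : 'M[F]_(d i) :=
  diag_mx (\row_j (rho j <= c)%:R) *m lead_mx (C i) (@rho i).

Lemma leading_spaceE c i j l :
  leading_space c i j l = (rho j <= c)%:R * (C i j l)`_(rho j).
Proof. by rewrite /leading_space mul_diag_mx !mxE. Qed.

Lemma rank_leading_space c i :
  \rank (leading_space c i) = #|[pred j | rho (i := i) j <= c]|%N.
Proof. by rewrite mxrankMfree ?rank_partial_diag // row_free_unit. Qed.

(** The pencil raises degrees by at most one, and its effect on the top
    coefficients is that of [M1].  The coefficient of degree [rho j + 1] of row
    [j] of [C *m pencil = A *m C] is computed in both ways; by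
    [predictable_degree] only rows of degree at most [rho j + 1] contribute to
    the right-hand side. *)
Lemma leading_space_stable c a :
  (leading_space c (source a) *m M1 a <= leading_space c.+1 (target a))%MS.
Proof.
apply/row_subP => j; rewrite row_mul.
have [le_jc|lt_cj] := leqP (rho j) c; last first.
  rewrite (_ : row j _ = 0) ?mul0mx ?sub0mx //.
  by apply/rowP => l; rewrite mxE leading_spaceE leqNgt lt_cj /= mul0r mxE.
have szCP l : (size (\sum_b A a j b * C (target a) b l)%R <= (rho j).+2)%N.
  rewrite -[X in size (polyseq X)](_ : (A a *m C (target a)) j l = _); last by rewrite mxE.
  rewrite -CA; apply/leq_sizeP => -[//|e] le_je; rewrite coef_mul_pencil big1 // => b _.
  by rewrite !nth_default ?mul0r ?addr0 // (leq_trans (Crho _ _)) //; lia.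
have degA := predictable_degree (w := A a j) (Crho (i := _)) (leadu _) szCP.
pose u : 'rV[F]_(d (target a)) := \row_b (A a j b)`_((rho j).+1 - rho b).
suff -> : row j (leading_space c (source a)) *m M1 a = u *m leading_space c.+1 (target a).
  exact: submxMl.
apply/rowP => l; rewrite mxE.
transitivity (((C (source a) *m pencil a) j l)`_(rho j).+1).
  rewrite coef_mul_pencil; apply: eq_bigr => b _.
  rewrite mxE leading_spaceE le_jc mul1r.
  by rewrite [_`_(rho j).+1]nth_default ?mul0r ?add0r //; apply: Crho.
rewrite CA !mxE coef_sum; apply: eq_bigr => b _; rewrite leading_spaceE mxE.
have [->|Ab] := eqVneq (A a j b) 0; first by rewrite mul0r !coef0 mul0r.
have := degA b Ab; have := Ab; rewrite -size_poly_gt0 => Ab_gt0 le_b.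
have le_bj : (rho b <= (rho j).+1)%N.
  by move: le_b Ab_gt0; move: (rho b) (rho j) (size _) => x y z; lia.
rewrite (leq_trans le_bj) // mul1r -{1}(subnK le_bj) coefM_top //; last exact: Crho.
by move: le_b le_bj; move: (rho b) (rho j) (size _) => x y z; lia.
Qed.

End LeadingSpaces.

Lemma sum_steps (n m : nat) (rho : 'I_n -> nat) : (forall j, rho j <= m)%N ->
  (\sum_j rho j + \sum_(c < m) #|[pred j | rho j <= c]| = m * n)%N.
Proof.
move=> le_m; under [X in (_ + X)%N]eq_bigr do rewrite -sum1_card big_mkcond.
rewrite exchange_big -big_split /= mulnC -[n in RHS]card_ord -sum_nat_const.
apply: eq_bigr => j _.
rewrite -(big_mkord xpredT (fun c => if (rho j <= c)%N then 1%N else 0%N)).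
rewrite (big_cat_nat (leq0n _) (le_m j)) //= big_nat big1 => [|c /andP[_ lt_c]]; last first.
  by rewrite leqNgt lt_c.
rewrite add0n big_nat (eq_bigr (fun=> 1%N)) => [|c /andP[-> _] //].
by rewrite -big_nat sum_nat_const_nat muln1 subnKC.
Qed.

Variables (R : realType) (theta : vertex Q -> R).

Lemma weight_le_norm (e : dimvec Q) : subdimvec e d ->
  weight theta e <= \sum_i `|theta i| * (d i)%:R.
Proof.
move=> led; apply: ler_sum => i _.
by rewrite (le_trans (ler_wpM2r _ (ler_norm _))) // ler_wpM2l // ler_nat.
Qed.

(** The colength at [i] is the sum over [c] of the codimensions of the leading
    spaces [h c i], so up to sign the weight of the lattice is the sum of the
    weights of the [h c].  If no row has degree [c + 1] then the leading space of
    index [c] equals the next one, hence is a subrepresentation of [M1] and has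
    weight at most [0]; this fails for at most as many [c] as there are rows,
    and each of these contributes at most [T]. *)
Lemma pencil_colength_bound : semistable theta M1 ->
  exists K : R, forall B N, intertwines B N pencil ->
    (forall i, \det (B i) != 0) -> - K <= weight theta (colength B).
Proof.
move=> sst; pose T := \sum_i `|theta i| * (d i)%:R.
have T_ge0 : 0 <= T by apply: sumr_ge0 => i _; rewrite mulr_ge0.
exists (T * (\sum_i d i)%N%:R) => B N BN detB0.
have /fin_all_exists[V /fin_all_exists[rho Vrho]] : forall i, exists Vi rhoi,
    [/\ Vi \in unitmx, row_degrees (Vi *m B i) rhoi & lead_mx (Vi *m B i) rhoi \in unitmx].
  move=> i; apply: (@row_reduction _ _ _ (fun j => \sum_l size (B i j l))%N) => // j l.
  by rewrite (bigD1 l) //= leqW // leq_addr.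
pose C : lattice F d := fun i => V i *m B i.
pose A : polyrep F d := fun a => V (source a) *m N a *m invmx (V (target a)).
have Vu i : V i \in unitmx by case: (Vrho i).
have Crho i : row_degrees (C i) (rho i) by case: (Vrho i).
have leadu i : lead_mx (C i) (rho i) \in unitmx by case: (Vrho i).
have CA : intertwines C A pencil.
  by move=> a; rewrite /C /A -(mulmxA (V _) (B _)) BN !mulmxA mulmxKV.
have detV i : (size (\det (V i))).-1 = 0%N.
  by have := Vu i; rewrite unitmxE poly_unitE => /andP[/eqP -> _].
have colB i : colength B i = (\sum_j rho i j)%N.
  have : size (\det (C i)) = (\sum_j rho i j).+1 by exact: size_det_row_reduced.
  move/(congr1 predn); rewrite det_mulmx degM // ?detV //.
  by have := Vu i; rewrite unitmxE; apply: contraTneq => ->; rewrite unitr0.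
pose m := (\sum_i \sum_j rho i j)%N.
have le_m i j : (rho i j <= m)%N.
  rewrite /m (bigD1 i) //= (bigD1 j) //= -addnA leq_addr //.
pose h c : dimvec Q := fun i => \rank (leading_space C rho c i).
pose g c := (\sum_i #|[pred j | rho i j == c]|)%N.
(* [g c.+1] counts the rows of degree [c + 1]. *)
have wh c : weight theta (h c) <= T * (g c.+1)%:R.
  have [g0|g_gt0] := posnP (g c.+1); last first.
    rewrite (le_trans (weight_le_norm (e := h c) _)) ?ler_peMr ?ler1n //.
    by move=> i; exact: rank_leq_row.
  rewrite g0 mulr0; apply: semistable_subrep sst _ => a.
  rewrite (submx_trans (leading_space_stable CA Crho leadu c a)) //.
  rewrite (_ : leading_space C rho c.+1 (target a) = leading_space C rho c (target a)) //.
  apply/matrixP => j l; rewrite !leading_spaceE leq_eqVlt ltnS.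
  move/eqP: g0; rewrite /g sum_nat_eq0 => /forallP/(_ (target a)) /=.
  by move=> /eqP/card0_eq/(_ j) /= e0; rewrite [_ == _]e0.
have sum_g : (\sum_(c < m) g c.+1 <= \sum_i d i)%N.
  rewrite /g exchange_big leq_sum // => i _.
  under eq_bigr do rewrite -sum1_card big_mkcond.
  rewrite exchange_big -[X in (_ <= X)%N]card_ord -sum1_card leq_sum // => j _.
  rewrite -big_mkcond sum1_card; apply/card_le1_eqP => c c'; rewrite !unfold_in => /eqP -> /eqP.
  by move=> /succn_inj/val_inj.
have mE i : (m * d i)%N = (colength B i + \sum_(c < m) h c i)%N.
  rewrite colB -(sum_steps (le_m i)); congr (_ + _)%N.
  by apply: eq_bigr => c _; rewrite /h rank_leading_space.
have := weight_add theta mE.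
rewrite weight_mull; case: sst => -> _; rewrite mulr0.
have -> : weight theta (fun i => \sum_(c < m) h c i)%N = \sum_(c < m) weight theta (h c).
  rewrite /weight exchange_big; apply: eq_bigr => i _ /=.
  by rewrite natr_sum mulr_sumr.
have : \sum_(c < m) weight theta (h c) <= T * (\sum_i d i)%N%:R.
  apply: (@le_trans _ _ (\sum_(c < m) T * (g c.+1)%:R)); first exact: ler_sum.
  rewrite -mulr_sumr -natr_sum.
  by rewrite ler_wpM2l // ler_nat.
lra.
Qed.

End Pencil.

(** * Semistable reduction and walls *)

Section SemistableReduction.
Variables (R : realType) (F : fieldType) (Q : quiver) (d : dimvec Q).
Implicit Types (theta eta : vertex Q -> R).

Lemma subdimvec_argmin (P : dimvec Q -> Prop) (f : dimvec Q -> R) :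
  (forall e, P e -> subdimvec e d) -> (exists e, P e) ->
  exists2 e, P e & forall e', P e' -> f e <= f e'.
Proof.
move=> Pd [e0 Pe0]; pose n := (\sum_i d i)%N.
pose dec (x : {ffun vertex Q -> 'I_n.+1}) : dimvec Q := fun i => nat_of_ord (x i).
have encK e : P e -> exists x, dec x = e.
  move=> Pe; exists [ffun i => inord (e i)]; apply: functional_extensionality_dep => i.
  rewrite /dec ffunE inordK // ltnS (leq_trans (Pd _ Pe i)) //.
  by rewrite /n (bigD1 i) //= leq_addr.
have [x0 ex0] := encK _ Pe0; have Px0 : `[< P (dec x0) >] by apply/asboolP; rewrite ex0.
case: (@arg_minP _ _ _ x0 (fun x => `[< P (dec x) >]) (f \o dec) Px0) => x /asboolP Px xmin.
exists (dec x) => // e' Pe'; have [x' ex'] := encK _ Pe'.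
by rewrite -ex'; apply: xmin; apply/asboolP; rewrite ex'.
Qed.

(** Real weights are not discrete, but destabilizing modifications change the
    weight of a lattice by one of finitely many positive numbers. *)
Lemma positive_weight_gap theta : exists2 delta : R, 0 < delta &
  forall e, subdimvec e d -> 0 < weight theta e -> delta <= weight theta e.
Proof.
pose P e := subdimvec e d /\ 0 < weight theta e.
have [[e [ed we]]|noP] := pselect (exists e, P e).
  have [||e' [_ we'] min] := @subdimvec_argmin P (weight theta); first by move=> ? [].
    by exists e.
  by exists (weight theta e') => // e'' d'' w''; apply: min.
by exists 1 => // e ed we; case: noP; exists e.
Qed.

(** Each destabilizing modification lowers the weight of the lattice by at least
    the gap [delta], and the weight is bounded below, so that modifying as long
    as the fibre is not semistable terminates.  The last clause records that
    the weight has dropped unless no modification was made. *)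
Lemma semistable_reduction theta (M0 M1 : rep F d) (N : polyrep F d) (B : lattice F d) :
  semistable theta M1 -> intertwines B N (pencil M0 M1) -> supported_at0 B ->
  exists N' B', [/\ intertwines B' N' (pencil M0 M1), supported_at0 B',
    semistable theta (fibre0 N'), weight theta (colength B') <= weight theta (colength B)
    & semistable theta (fibre0 N) \/ weight theta (colength B') < weight theta (colength B)].
Proof.
move=> sst1; have [K Kbound] := pencil_colength_bound M0 sst1.
have [delta delta_gt0 gap] := positive_weight_gap theta.
have [n] : exists n : nat, weight theta (colength B) + K < n%:R * delta.
  exists (Num.bound `|(weight theta (colength B) + K) / delta|).
  by rewrite -ltr_pdivrMr // (le_lt_trans (ler_norm _)) // archi_boundP.
elim: n => [|n IHn] in N B * => lt_n BN B0.
  have [m Bm] := B0; have := Kbound B N BN (fun i => dvdp_Xn_neq0 (Bm i)).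
  by rewrite mul0r in lt_n; lra.
have [sstN|nsst] := pselect (semistable theta (fibre0 N)).
  by exists N, B; split=> //; left.
have [U sU wU] : exists2 U, subrep (fibre0 N) U & 0 < weight theta (dim_subspaces U).
  apply: contrapT => noU; apply: nsst; apply/weight_dim_leP; split=> [|U sU].
    by case: sst1.
  by rewrite leNgt; apply/negP => wU; apply: noU; exists U.
have [G [N' [GN' GU]]] := elementary_modification sU.
have [G0 colG] := colength_modification (fun i => (GU i).2).
pose B' : lattice F d := fun i => G i *m B i.
have B'N' : intertwines B' N' (pencil M0 M1) by apply: intertwines_comp BN GN'.
have B'0 : supported_at0 B' by apply: supported_at0_comp.
have leU : subdimvec (dim_subspaces U) d by move=> i; apply: rank_leq_row.
have wB' : weight theta (colength B') =
    weight theta (colength B) - weight theta (dim_subspaces U).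
  have [[m Bm] [m' Gm]] := (B0, G0).
  rewrite (@weight_add _ _ _ _ (subdv d (dim_subspaces U)) (colength B)); last first.
    by move=> i; rewrite colength_comp ?(dvdp_Xn_neq0 (Bm i)) ?(dvdp_Xn_neq0 (Gm i)) // colG.
  by rewrite weight_sub //; case: sst1 => -> _; rewrite sub0r addrC.
have := gap _ leU wU => le_delta.
have [|//|//|N'' [B'' [h1 h2 h3 h4 h5]]] := IHn N' B'.
  by move: lt_n; rewrite -natr1 mulrDl mul1r; lra.
by exists N'', B''; split=> //; [lra | right; lra].
Qed.

(** At the lattice produced by semistable reduction, the weights for [theta]
    and [eta] are negative and nonpositive, while their combination is
    nonnegative. *)
Lemma semistable_of_interp theta eta (t : R) (M0 M1 : rep F d) :
  (forall M : rep F d, semistable theta M -> semistable eta M) ->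
  semistable theta M1 -> 0 < t <= 1 ->
  semistable (fun i => t * theta i + (1 - t) * eta i) M0 -> semistable theta M0.
Proof.
move=> te sst1 /andP[t0 t1] sst0.
pose B : lattice F d := fun i => 1%:M.
have BP : intertwines B (pencil M0 M1) (pencil M0 M1) by move=> a; rewrite mul1mx mulmx1.
have B0 : supported_at0 B by exists 0%N => i; rewrite det1.
have wB : weight theta (colength B) = 0.
  by rewrite /weight big1 // => i _; rewrite /colength det1 size_poly1 mulr0.
have [N [B' [B'N B'0 sstN _]]] := semistable_reduction sst1 BP B0.
rewrite fibre0_pencil wB; case=> // wB'.
have := colength_le0 (te _ sstN) B'N B'0.
move: sst0; rewrite -{1}(fibre0_pencil M0 M1) => sst0.
have := colength_ge0 sst0 B'N B'0; rewrite weight_interp.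
nra.
Qed.

Section DirectSum.
Variables (e f : dimvec Q) (s : splitting F d e f) (N : rep F e) (L : rep F f).

Definition direct_sum : rep F d := fun a =>
  spl_out s (source a) *m N a *m spl_in s (target a) +
  spl_out' s (source a) *m L a *m spl_in' s (target a).

Lemma spl_in_direct_sum a : spl_in s (source a) *m direct_sum a = N a *m spl_in s (target a).
Proof. by rewrite mulmxDr !mulmxA spl_inK spl_in0 !mul0mx mul1mx addr0. Qed.

Lemma spl_in'_direct_sum a : spl_in' s (source a) *m direct_sum a = L a *m spl_in' s (target a).
Proof. by rewrite mulmxDr !mulmxA spl_inK' spl_in0' !mul0mx mul1mx add0r. Qed.

Lemma semistable_direct_sum theta : weight theta d = 0 ->
  semistable theta direct_sum <-> semistable theta N /\ semistable theta L.
Proof.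
move=> wd.
have stable a : (spl_in s (source a) *m direct_sum a <= spl_in s (target a))%MS.
  by rewrite spl_in_direct_sum submxMl.
have stable' a : (spl_in' s (source a) *m direct_sum a <= spl_in' s (target a))%MS.
  by rewrite spl_in'_direct_sum submxMl.
have <- : subrep_of s direct_sum = N.
  apply: functional_extensionality_dep => a.
  by rewrite /subrep_of spl_in_direct_sum -mulmxA spl_inK mulmx1.
have <- : quotrep_of s direct_sum = L.
  apply: functional_extensionality_dep => a.
  by rewrite /quotrep_of spl_in'_direct_sum -mulmxA spl_inK' mulmx1.
split=> [sst|[]]; last exact: semistable_ext.
apply: semistable_sub_quot => //.
have := semistable_subrep sst stable; have := semistable_subrep sst stable'.
have rin i : \rank (spl_in s i) = e i.
  by apply/eqP/row_freeP; exists (spl_out s i); rewrite spl_inK.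
have rin' i : \rank (spl_in' s i) = f i.
  by apply/eqP/row_freeP; exists (spl_out' s i); rewrite spl_inK'.
rewrite (eq_weight _ rin) (eq_weight _ rin').
have := weight_add theta (spl_dim s); lra.
Qed.

End DirectSum.

Lemma splitting_subdimvec e : subdimvec e d -> inhabited (splitting F d e (subdv d e)).
Proof.
move=> ed; have [|i|s _] := @splitting_subspaces F Q d e (subdv d e) (fun i => pid_mx (e i)).
- by move=> i; rewrite rank_pid_mx.
- by rewrite subnKC.
by exists.
Qed.

(** Among the dimension vectors [e] of the subrepresentations with positive
    [eta]-weight, choose one whose weight is the first to vanish on the way
    from [theta] to [eta]. *)
Lemma wall_crossing theta eta (M : rep F d) :
  semistable theta M -> weight eta d = 0 -> ~ semistable eta M ->
  exists e, [/\ subdimvec e d, 0 < weight eta e & segment theta eta `&` wall F d e !=set0].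
Proof.
move=> sst we nsst; have /weight_dim_leP[wt sstU] := sst.
pose P e := exists2 U, subrep M U & dim_subspaces U = e /\ 0 < weight eta e.
(* The fraction of the way from [theta] to [eta] at which the weight of [e] vanishes. *)
pose exit e := - weight theta e / (weight eta e - weight theta e).
have Pd e : P e -> subdimvec e d by move=> [U _ [<- _]] i; apply: rank_leq_row.
have exP : exists e, P e.
  apply: contrapT => noP; apply: nsst; apply/weight_dim_leP; split=> // U sU.
  rewrite leNgt; apply/negP => wU; apply: noP.
  by exists (dim_subspaces U), U.
have [e [U sU [eU we_gt0]] exit_min] := subdimvec_argmin exit Pd exP.
have te_le0 : weight theta e <= 0 by rewrite -eU; apply: sstU.
have exitP (a b : R) : a <= 0 -> 0 < b -> (- a / (b - a)) * (b - a) = - a.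
  by move=> *; rewrite divfK //; apply/eqP; lra.
have s_eq := exitP _ _ te_le0 we_gt0; rewrite -/(exit e) in s_eq.
have s_ge0 : 0 <= exit e by rewrite /exit divr_ge0; lra.
have s_le1 : exit e <= 1 by rewrite /exit ler_pdivrMr; lra.
pose zeta i := (1 - exit e) * theta i + (1 - (1 - exit e)) * eta i.
have wzeta e' : weight zeta e' =
    weight theta e' + exit e * (weight eta e' - weight theta e').
  by rewrite weight_interp; ring.
have zeta_e : weight zeta e = 0 by rewrite wzeta s_eq; ring.
have zeta_sst : semistable zeta M.
  apply/weight_dim_leP; split=> [|U' sU']; first by rewrite wzeta wt we; ring.
  have tU' := sstU _ sU'; rewrite wzeta.
  have [eU'|eU'] := leP (weight eta (dim_subspaces U')) 0; first by nra.
  have := exit_min (dim_subspaces U'); rewrite /P => /(_ (ex_intro2 _ _ U' sU' (conj erefl eU'))).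
  have := exitP _ _ tU' eU'; rewrite -/(exit _); nra.
exists e; split=> //; first by apply: Pd; exists U.
have ed : subdimvec e d by apply: Pd; exists U.
have [||s sE] := @splitting_subspaces F Q d e (subdv d e) U.
- by move=> i; rewrite -eU.
- by move=> i; rewrite subnKC.
have stable a : (spl_in s (source a) *m M a <= spl_in s (target a))%MS.
  by rewrite sE (eqmxMr _ (sE _)); apply: sU.
have [sub quot] := semistable_sub_quot stable zeta_sst zeta_e.
exists zeta; split; first by exists (1 - exit e) => //; apply/andP; split; lra.
split; split; [by case: sub | by exists (subrep_of s M) | by case: quot | by exists (quotrep_of s M)].
Qed.

Lemma segment_sym theta eta : segment theta eta = segment eta theta.
Proof.
suff sub x y : segment (Q := Q) (R := R) x y `<=` segment y x by apply/seteqP; split.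
move=> _ [t t01 ->]; exists (1 - t); first by move/andP: t01 => [? ?]; apply/andP; split; lra.
by apply: functional_extensionality_dep => i; ring.
Qed.

Lemma segment_left theta eta : segment theta eta theta.
Proof.
exists 1; first by rewrite ler01 lexx.
by apply: functional_extensionality_dep => i; ring.
Qed.

Lemma segment_right theta eta : segment theta eta eta.
Proof. by rewrite segment_sym; apply: segment_left. Qed.

(** Contained in a wall through a crossing point, the segment would have its
    end [eta] on it, whereas [eta] is positive on the dimension vector of that
    wall. *)
Lemma sst_locus_subset theta eta : weight eta d = 0 ->
  (forall e : dimvec Q, subdimvec e d ->
    (exists i, e i <> 0%N) -> (exists i, e i <> d i) ->
    segment theta eta `<=` wall F d e \/ segment theta eta `&` wall F d e = set0) ->
  sst_locus F d theta `<=` sst_locus F d eta.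
Proof.
move=> we walls M sst; apply: contrapT => nsst.
have [e [ed we_gt0 [zeta meets]]] := wall_crossing sst we nsst.
have neq (e' : dimvec Q) : weight eta e' = 0 -> exists i, e i <> e' i.
  move=> we'; apply: contrapT => noi.
  suff ee' : e = e' by rewrite ee' we' ltxx in we_gt0.
  apply: functional_extensionality_dep => i; apply: contrapT => ni; apply: noi; by exists i.
case: (walls e ed _ (neq d we)) => [|inW|disj].
- by apply: (neq (fun=> 0%N)); rewrite /weight big1 // => i _; rewrite mulr0.
- by have [[+ _] _] := inW _ (segment_right theta eta); rewrite /perp /= => e0; rewrite e0 ltxx in we_gt0.
- by rewrite disj in meets.
Qed.

End SemistableReduction.

Theorem theorem1p2 (R : realType) (k : closedFieldType)
    (k_char0 : [pchar k] =i pred0) (Q : quiver) (d : dimvec Q)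
    (theta eta : vertex Q -> R)
    (theta_sst : sst k d theta) (eta_sst : sst k d eta) :
  git_equiv k d theta eta <->
  forall e : dimvec Q, subdimvec e d ->
    (exists i, e i <> 0%N) -> (exists i, e i <> d i) ->
    segment theta eta `<=` wall k d e \/
    segment theta eta `&` wall k d e = set0.
Proof.
have [[wt [M1 sst1]] [we _]] := (theta_sst, eta_sst).
split=> [git e ed _ _|walls]; last first.
  apply/seteqP; split; apply: sst_locus_subset => // e ed e0 ned.
  by rewrite segment_sym; apply: walls.
have locE (M : rep k d) : semistable theta M = semistable eta M.
  exact: (congr1 (fun X : set (rep k d) => X M) git).
have [[zeta [[t t01 zetaE] [[_ [N sstN]] [_ [L sstL]]]]]|nomeet] :=
    pselect (segment theta eta `&` wall k d e !=set0); last first.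
  right; apply/seteqP; split=> // x xin; case: nomeet; by exists x.
left=> xi [u u01 ->].
have [s] := splitting_subdimvec k ed.
have wzeta : weight zeta d = 0 by rewrite zetaE weight_interp wt we !mulr0 addr0.
have : semistable zeta (direct_sum s N L) by apply/semistable_direct_sum.
rewrite zetaE => sstM.
(* [t = 0] is the end [zeta = eta] of the segment, which [semistable_of_interp] leaves out. *)
have sstMt : semistable theta (direct_sum s N L).
  have [t0|t_gt0] := eqVneq t 0.
    rewrite locE; suff <- : (fun i => t * theta i + (1 - t) * eta i) = eta by [].
    by apply: functional_extensionality_dep => i; rewrite t0; ring.
  have [t_ge0 t_le1] := andP t01.
  apply: (semistable_of_interp (t := t) _ sst1 _ sstM); first by move=> M; rewrite locE.
  by rewrite lt_def t_gt0 t_ge0.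
have sstMe : semistable eta (direct_sum s N L) by rewrite -locE.
have [tN tL] := (semistable_direct_sum s N L wt).1 sstMt.
have [eN eL] := (semistable_direct_sum s N L we).1 sstMe.
have uN := semistable_interp u01 tN eN; have uL := semistable_interp u01 tL eL.
by split; split; [case: uN | exists N | case: uL | exists L].
Qed.
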